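(* Let $(X,L,\delta)$ be a (semimetric-like) ordinal space such that there is no least element in $L\setminus\{0\}$. Define a system $\mathfrak U$ of subsets of $X\times X$ by: $U\in\mathfrak U$ if and only if there exists a cut $(A,B)$ of the set $L$ with $A\setminus\{0\}\neq\varnothing$ such that the implication $$\delta(u,v)\in A\ \Rightarrow\ (u,v)\in U$$ holds for all $u,v\in X$. For $U\in\mathfrak U$ and $x\in X$ let $U[x]=\{y\in X\mid(x,y)\in U\}$. Define the set $\mathfrak O$ of subsets $O$ of $X$ as follows: $O\in\mathfrak O$ if and only if for each $x\in O$ there exists some $U\in\mathfrak U$ with $U[x]\subseteq O$. Then $\mathfrak O$ is a topology on $X$.
   Context: An ordinal space is an ordered triplet $(X,L,\delta)$, where $X$ is a set, $L$ is a linearly ordered set with minimal element $0$, and $\delta\colon X\times X\to L$ is a surjective mapping such that for all $x,y\in X$: (i) $\delta(x,y)=\delta(y,x)$; (ii) $\delta(x,y)=0$ if and only if $x=y$. A cut $(A,B)$ of a linearly ordered set $S$ is a pair with $S=A\cup B$ such that each element of $A$ is less than each element of $B$ ($A$ or $B$ may be empty). An ordinal space is semimetric-like if there is a function $d\colon X\times X\to[0,\infty)$ with $d(x,y)=d(y,x)$ and ($d(x,y)=0\Leftrightarrow x=y$) for all $x,y\in X$, such that for all $x,y,z,w\in X$ the comparison ($<$, $=$, $>$) of $\delta(x,y)$ with $\delta(z,w)$ agrees with that of $d(x,y)$ with $d(z,w)$.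
   Formalization: The formal statement additionally assumes that L\{0} is nonempty, which excludes exactly the one-point space, where no admissible cut exists and X itself is not in 𝔒; it is proved for all ordinal spaces, not only semimetric-like ones. *)

(* Defs.v *)
From mathcomp Require Import all_boot all_order.
From mathcomp Require Import boolp classical_sets.

Set Implicit Arguments.
Unset Strict Implicit.
Unset Printing Implicit Defensive.

Import Order.TTheory.
Local Open Scope order_scope.
Local Open Scope classical_set_scope.

(* The minimal element 0 of the linearly ordered set L is \bot. *)
Definition ordinal_space (X : Type) (d : Order.disp_t) (L : bOrderType d)
    (delta : X -> X -> L) : Prop :=
  [/\ forall l, exists x y, delta x y = l,
      forall x y, delta x y = delta y x &
      forall x y, delta x y = \bot <-> x = y].

Definition cut (d : Order.disp_t) (S : orderType d) (A B : set S) : Prop :=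
  A `|` B = setT /\ forall a b, A a -> B b -> a < b.

Definition entourages (X : Type) (d : Order.disp_t) (L : bOrderType d)
    (delta : X -> X -> L) : set (set (X * X)) :=
  [set U | exists A B : set L,
    [/\ cut A B,
        A `\ \bot !=set0 &
        forall u v : X, A (delta u v) -> U (u, v)]].

(* xsection U x is the slice U[x] = {y | (x, y) in U}. *)
Definition system_opens (X : Type) (UU : set (set (X * X))) : set (set X) :=
  [set O | forall x, O x -> exists2 U, UU U & xsection U x `<=` O].

Definition is_topology (X : Type) (O : set (set X)) : Prop :=
  [/\ O set0,
      O setT,
      setI_closed O &
      forall F : set (set X), F `<=` O -> O (\bigcup_(A in F) A)].

(* Main.v *)
Require Import Defs.
From mathcomp Require Import all_boot all_order.
From mathcomp Require Import boolp classical_sets.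

Import Order.TTheory.
Local Open Scope order_scope.
Local Open Scope classical_set_scope.

(** Any nonempty system of relations on [X] that is stable under binary
    intersection yields a topology in this way: nonemptiness makes the whole
    space open, and stability makes the intersection of two opens open
    ([is_topology_system_opens]); for unions, the witness of one member serves.

    The entourages form such a system. As [L] has a nonzero element, taking all of
    [L] as the lower half of a cut gives an entourage. For stability, the lower
    halves of two cuts are initial segments of a linear order, so one of them
    contains the other ([cut_lower_total]); the cut with the smaller lower half
    then witnesses that the intersection is an entourage. *)

Lemma is_topology_system_opens (X : Type) (UU : set (set (X * X))) :
  UU !=set0 -> setI_closed UU -> is_topology (system_opens UU).
Proof.
move=> [U0 UU0] UUI; split.
- by [].
- by move=> x _; exists U0.
- move=> O1 O2 open1 open2 x [O1x O2x].
  have [U1 UU1 sub1] := open1 x O1x.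
  have [U2 UU2 sub2] := open2 x O2x.
  exists (U1 `&` U2); first exact: UUI.
  by rewrite xsectionI; apply: setISS.
- move=> F openF x [A FA Ax].
  have [U UU_U subA] := openF A FA x Ax.
  by exists U => // y Uy; exists A => //; apply: subA.
Qed.

Lemma cut_lower_total (d : Order.disp_t) (S : orderType d) (A B A' B' : set S) :
  cut A B -> cut A' B' -> A `<=` A' \/ A' `<=` A.
Proof.
move=> [ABT ltAB] [ABT' ltAB'].
have [|/existsNP[a /not_implyP[Aa nA'a]]] := pselect (A `<=` A'); first by left.
right=> a' A'a'.
have B'a : B' a by have : setT a by []; rewrite -ABT' => -[].
have lt_a'a : a' < a := ltAB' _ _ A'a' B'a.
have : setT a' by [].
rewrite -ABT => -[//|Ba'].
by have := lt_trans lt_a'a (ltAB _ _ Aa Ba'); rewrite ltxx.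
Qed.

Lemma entouragesT (X : Type) (d : Order.disp_t) (L : bOrderType d)
    (delta : X -> X -> L) :
  (exists l : L, l <> \bot) -> entourages delta setT.
Proof.
move=> [l l_neq0]; exists setT, set0; split=> //; last by exists l.
by split; [rewrite setU0 | move=> a b _ []].
Qed.

Lemma entouragesI (X : Type) (d : Order.disp_t) (L : bOrderType d)
    (delta : X -> X -> L) : setI_closed (entourages delta).
Proof.
move=> U V [A [B [cutAB A_neq0 AU]]] [A' [B' [cutAB' A'_neq0 A'V]]].
have [AA'|A'A] := cut_lower_total _ _ _ _ _ _ cutAB cutAB'.
- exists A, B; split=> // u v Auv.
  by split; [exact: AU | exact/A'V/AA'].
- exists A', B'; split=> // u v A'uv.
  by split; [exact/AU/A'A | exact: A'V].
Qed.

(* hL is needed: if L = {0}, then X is a singleton, L \ {0} = set0 has no least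
   element, no cut is admissible and the opens reduce to set0 alone. *)
Theorem proposition4p5 (X : Type) (d : Order.disp_t) (L : bOrderType d)
    (delta : X -> X -> L) (hdelta : ordinal_space delta)
    (hL : exists l : L, l <> \bot)
    (hleast : ~ exists2 m : L, m <> \bot & forall l : L, l <> \bot -> m <= l) :
  is_topology (system_opens (entourages delta)).
Proof.
apply: is_topology_system_opens; last exact: entouragesI.
by exists setT; apply: entouragesT.
Qed.
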